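(* Let $X\in\mathbb{R}^{n\times p}$, let $\mathrm{pen}:\mathbb{R}^p\to\mathbb{R}$ be a polyhedral gauge, and let $\beta\in\mathbb{R}^p$. Then $\beta$ satisfies the noiseless recovery condition with respect to $X$ and $\mathrm{pen}$ if and only if $$X'X\,\mathrm{lin}(C_\beta) \cap \partial_{\mathrm{pen}}(\beta) \neq \varnothing.$$
   Context: A prime denotes transpose. A (real-valued) polyhedral gauge on $\mathbb{R}^p$ is a function of the form $\mathrm{pen}(b) = \max\{u_1'b,\dots,u_k'b\}$ for some $u_1,\dots,u_k \in \mathbb{R}^p$ with $u_1 = 0$; $\partial_{\mathrm{pen}}(\beta)$ is its subdifferential at $\beta$. For $y\in\mathbb{R}^n$ and $\lambda>0$ let $S_{X,\lambda\mathrm{pen}}(y) = \mathrm{Arg}\min_{b\in\mathbb{R}^p} \frac12\|y-Xb\|_2^2 + \lambda\,\mathrm{pen}(b)$. Write $b \overset{\mathrm{pen}}{\sim} \beta$ if $\partial_{\mathrm{pen}}(b) = \partial_{\mathrm{pen}}(\beta)$, and let $C_\beta = \{b\in\mathbb{R}^p : b\overset{\mathrm{pen}}{\sim}\beta\}$; $\mathrm{lin}$ denotes linear span and $X'X\,\mathrm{lin}(C_\beta)$ is the image of $\mathrm{lin}(C_\beta)$ under $X'X$. $\beta$ satisfies the noiseless recovery condition with respect to $X$ and $\mathrm{pen}$ if there exist $\lambda>0$ and $\hat\beta\in S_{X,\lambda\mathrm{pen}}(X\beta)$ such that $\hat\beta\overset{\mathrm{pen}}{\sim}\beta$. *)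

(* Defs.v *)
From mathcomp Require Import all_boot all_order all_algebra.
From mathcomp Require Import boolp classical_sets reals.

Set Implicit Arguments.
Unset Strict Implicit.
Unset Printing Implicit Defensive.

Import Order.TTheory GRing.Theory Num.Theory.

Local Open Scope classical_set_scope.
Local Open Scope ring_scope.

Definition dotv (R : realType) (m : nat) (u v : 'cV[R]_m) : R :=
  (u^T *m v) 0 0.

(* The library norm `|v| on matrices is the sup norm. *)
Definition l2norm (R : realType) (m : nat) (v : 'cV[R]_m) : R :=
  Num.sqrt (\sum_i v i 0 ^+ 2).

(* The neutral element of the iterated maximum is one of the terms, so that
   the right-hand side is the maximum of the k.+1 terms. *)
Definition polyhedral_gauge (R : realType) (p : nat) (pen : 'cV[R]_p -> R) :
    Prop :=
  exists (k : nat) (u : 'I_k.+1 -> 'cV[R]_p),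
    u ord0 = 0 /\
    forall b, pen b = \big[Num.max/dotv (u ord0) b]_(i < k.+1) dotv (u i) b.

Definition subdifferential (R : realType) (p : nat) (f : 'cV[R]_p -> R)
    (b : 'cV[R]_p) : set 'cV[R]_p :=
  [set s | forall z, f b + dotv s (z - b) <= f z].

Definition argmin (R : realType) (T : Type) (f : T -> R) : set T :=
  [set b | forall z, f b <= f z].

(* The penalty is passed already multiplied by the tuning parameter. *)
Definition penalized_ls (R : realType) (n p : nat) (X : 'M[R]_(n, p))
    (pen : 'cV[R]_p -> R) (y : 'cV[R]_n) : set 'cV[R]_p :=
  argmin (fun b => 2^-1 * l2norm (y - X *m b) ^+ 2 + pen b).

Definition pen_equiv (R : realType) (p : nat) (pen : 'cV[R]_p -> R)
    (b beta : 'cV[R]_p) : Prop :=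
  subdifferential pen b = subdifferential pen beta.

Definition pattern_class (R : realType) (p : nat) (pen : 'cV[R]_p -> R)
    (beta : 'cV[R]_p) : set 'cV[R]_p :=
  [set b | pen_equiv pen b beta].

(* The library's <<s>>%VS spans a finite sequence; the span of a possibly
   infinite set is the union of the spans of its finite sequences. *)
Definition lin (R : realType) (p : nat) (A : set 'cV[R]_p) : set 'cV[R]_p :=
  [set v | exists2 s : seq 'cV[R]_p, [set` s] `<=` A & v \in <<s>>%VS].

Definition noiseless_recovery (R : realType) (n p : nat) (X : 'M[R]_(n, p))
    (pen : 'cV[R]_p -> R) (beta : 'cV[R]_p) : Prop :=
  exists2 lambda : R, 0 < lambda &
    exists2 betahat : 'cV[R]_p,
      penalized_ls X (fun b => lambda * pen b) (X *m beta) betahat &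
      pen_equiv pen betahat beta.

(* Main.v *)
Require Import Defs.
From mathcomp Require Import all_boot all_order all_algebra.
From mathcomp Require Import boolp classical_sets reals.
From mathcomp Require Import ring lra.

(** Write pen b as the maximum of the u_i'b and call i active at b when
    u_i'b = pen b.  Everything rests on two facts.

    Fermat's rule ([penalized_lsP]): b minimizes the penalized least-squares
    criterion iff X'(y - Xb) = lambda s for a subgradient s of pen at b.  For
    y = X beta the left-hand side is X'X(beta - b).

    Stability of patterns ([pattern_class_shift]): if v is in lin(C_beta), then
    beta + t v is in C_beta for all small t.  Indeed the active u_i are
    subgradients at beta, hence at every b in C_beta, hence active at b: the
    number u_i'b is the same for all i active at beta.  This property passes to
    linear combinations, so it holds for v, with common value c say.  Near beta
    the inactive u_i stay strictly below the maximum, so that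
    pen (beta + t v) = pen beta + t c for small t of either sign; and the
    subdifferential is constant along a segment in whose neighbourhood the
    function is affine ([subdifferential_shift]).

    If b recovers the pattern of beta, then X'X(lambda^-1 (beta - b)) is a
    subgradient at b, equivalently at beta, and beta - b is in lin(C_beta).
    Conversely, if X'X v is a subgradient at beta with v in lin(C_beta), then
    b = beta - lambda v has the pattern of beta for small lambda, and
    X'X(beta - b) = lambda X'X v makes it a minimizer. *)

Import Order.TTheory GRing.Theory Num.Theory.
Local Open Scope classical_set_scope.
Local Open Scope ring_scope.

(** * The inner product *)

Section InnerProduct.
Context {R : realType}.
Implicit Types (m n : nat) (a : R).

Lemma dotvE {m} (u v : 'cV[R]_m) : dotv u v = \sum_i u i 0 * v i 0.
Proof. by rewrite /dotv mxE; apply: eq_bigr => i _; rewrite mxE. Qed.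

Lemma dotvC {m} (u v : 'cV[R]_m) : dotv u v = dotv v u.
Proof. by rewrite !dotvE; apply: eq_bigr => i _; rewrite mulrC. Qed.

Lemma dotvDr {m} (u v w : 'cV[R]_m) : dotv u (v + w) = dotv u v + dotv u w.
Proof. by rewrite /dotv mulmxDr mxE. Qed.

Lemma dotvZr {m} a (u v : 'cV[R]_m) : dotv u (a *: v) = a * dotv u v.
Proof. by rewrite /dotv -scalemxAr mxE. Qed.

Lemma dotvNr {m} (u v : 'cV[R]_m) : dotv u (- v) = - dotv u v.
Proof. by rewrite -scaleN1r dotvZr mulN1r. Qed.

Lemma dotvBr {m} (u v w : 'cV[R]_m) : dotv u (v - w) = dotv u v - dotv u w.
Proof. by rewrite dotvDr dotvNr. Qed.

Lemma dotv0r {m} (u : 'cV[R]_m) : dotv u 0 = 0.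
Proof. by rewrite -(scale0r 0) dotvZr mul0r. Qed.

Lemma dotvZl {m} a (u v : 'cV[R]_m) : dotv (a *: u) v = a * dotv u v.
Proof. by rewrite dotvC dotvZr dotvC. Qed.

Lemma dotv_ge0 {m} (u : 'cV[R]_m) : 0 <= dotv u u.
Proof. by rewrite dotvE; apply: sumr_ge0 => i _; rewrite -expr2 sqr_ge0. Qed.

Lemma dotv_trmx {m n} (X : 'M[R]_(m, n)) (r : 'cV_m) (d : 'cV_n) :
  dotv (X^T *m r) d = dotv r (X *m d).
Proof. by rewrite /dotv trmx_mul trmxK mulmxA. Qed.

Lemma l2norm_sqr {m} (v : 'cV[R]_m) : l2norm v ^+ 2 = dotv v v.
Proof.
rewrite /l2norm sqr_sqrtr; last by apply: sumr_ge0 => i _; rewrite sqr_ge0.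
by rewrite dotvE; apply: eq_bigr => i _; rewrite expr2.
Qed.

Lemma half_l2norm_sqrD {m} (v w : 'cV[R]_m) :
  2^-1 * l2norm (v + w) ^+ 2 =
  2^-1 * l2norm v ^+ 2 + dotv v w + 2^-1 * dotv w w.
Proof.
rewrite !l2norm_sqr dotvDr !(dotvC (v + w)) !dotvDr (dotvC w v).
by field.
Qed.

End InnerProduct.

(** * Linear spans *)

Section Span.
Context {R : realType} {p : nat}.
Implicit Types (A : set 'cV[R]_p) (x y v : 'cV[R]_p).

Lemma lin_ind A (P : 'cV[R]_p -> Prop) : P 0 ->
  (forall (a : R) x v, A x -> P v -> P (a *: x + v)) ->
  forall v, lin A v -> P v.
Proof.
move=> P0 PD v [s sA /(coord_span (X := in_tuple s))->].
elim/big_rec: _ => // i x _ Px; apply: PD => //.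
by apply: sA; apply: mem_nth.
Qed.

Lemma lin_scaleB A (a : R) x y : A x -> A y -> lin A (a *: (x - y)).
Proof.
move=> Ax Ay; exists [:: x; y].
  by move=> z /=; rewrite !inE => /orP[] /eqP->.
by rewrite memvZ// memvB// memv_span// !inE eqxx ?orbT.
Qed.

End Span.

(** * Subdifferentials *)

(** Evaluating the subgradient inequality at the two ends of a segment on which
    f is affine shows that a subgradient s at the midpoint has the same slope
    as f along the segment; the supporting affine function given by s thus
    touches f at the end points as well. *)
Lemma subdifferential_shift {R : realType} {p : nat} (f : 'cV[R]_p -> R)
    (b d : 'cV[R]_p) (c : R) :
  f (b + d) = f b + c -> f (b - d) = f b - c ->
  subdifferential f b `<=` subdifferential f (b + d).
Proof.
move=> fD fB s sb z.
have := sb (b + d); have := sb (b - d); have := sb z.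
rewrite fD fB [_ - d]addrC [b + d]addrC !addrK dotvNr !dotvBr dotvDr.
lra.
Qed.

(** Fermat's rule.  Expanding the square at z, the criterion at z exceeds the
    one at b by lambda (pen z - pen b) - (X'r)'(z - b) + |X(z - b)|^2 / 2 with
    r = y - X b.  The last term is nonnegative, and negligible when z approaches
    b along a segment, on which pen lies below its chord. *)
Lemma penalized_lsP {R : realType} {n p : nat} (X : 'M[R]_(n, p))
    (pen : 'cV[R]_p -> R) (lambda : R) (y : 'cV[R]_n) (b s : 'cV[R]_p) :
  (forall x z t, 0 <= t <= 1 ->
    pen (x + t *: (z - x)) <= pen x + t * (pen z - pen x)) ->
  0 < lambda -> X^T *m (y - X *m b) = lambda *: s ->
  penalized_ls X (fun x => lambda * pen x) y b <-> subdifferential pen b s.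
Proof.
move=> pen_chord l0 rs.
have expand d : 2^-1 * l2norm (y - X *m (b + d)) ^+ 2 =
    2^-1 * l2norm (y - X *m b) ^+ 2 - lambda * dotv s d +
    2^-1 * dotv (X *m d) (X *m d).
  have -> : y - X *m (b + d) = y - X *m b + X *m - d.
    by rewrite mulmxDr mulmxN opprD addrA.
  rewrite half_l2norm_sqrD -dotv_trmx rs mulmxN dotvZl !dotvNr.
  by rewrite (dotvC (- _)) dotvNr opprK mulrN.
split=> [bmin z | sb z]; last first.
  have := expand (z - b); rewrite subrKC => ->.
  have := dotv_ge0 (X *m (z - b)); have := sb z.
  rewrite -(ler_pM2l l0) mulrDr.
  lra.
set D := pen z - pen b - dotv s (z - b).
suff : 0 <= D by rewrite /D; lra.
set q := dotv (X *m (z - b)) (X *m (z - b)).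
have q0 : 0 <= q := dotv_ge0 _.
have slope t : 0 < t <= 1 -> 0 <= lambda * D + 2^-1 * t * q.
  move=> /andP[t0 t1].
  have := bmin (b + t *: (z - b)).
  have := pen_chord b z t; rewrite (ltW t0) t1 => /(_ isT).
  rewrite expand -scalemxAr dotvZl !dotvZr -/q.
  rewrite -(ler_pM2l l0) -(pmulr_rge0 _ t0) /D.
  lra.
(* If D < 0, then t = - lambda D / (q - lambda D) is in ]0, 1] and makes the
   linear term dominate the quadratic one. *)
rewrite leNgt; apply/negP => Dlt0.
have e0 : 0 < - (lambda * D) by rewrite oppr_gt0 pmulr_rlt0.
set e := - (lambda * D) in e0 slope *.
have qe0 : 0 < q + e by lra.
have /slope : 0 < e / (q + e) <= 1.
  by rewrite divr_gt0//= ler_pdivrMr// mul1r; lra.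
have : e / (q + e) * q <= e.
  by rewrite mulrAC ler_pdivrMr// ler_pM2l//; lra.
have -> : lambda * D = - e by rewrite opprK.
lra.
Qed.

(** * Maxima of linear forms *)

(** The pointwise maximum of the forms u_i, split into its two halves so that
    the proofs never manipulate an iterated maximum. *)
Definition max_of_forms {R : realType} {p k : nat} (u : 'I_k -> 'cV[R]_p)
    (pen : 'cV[R]_p -> R) : Prop :=
  (forall i b, dotv (u i) b <= pen b) /\
  (forall b, exists i, pen b = dotv (u i) b).

Section MaxOfForms.
Context {R : realType} {p k : nat} (u : 'I_k -> 'cV[R]_p) (pen : 'cV[R]_p -> R)
  (penP : max_of_forms u pen).
Implicit Types (b beta v z : 'cV[R]_p) (t c : R).

Lemma max_of_forms_chord x z t : 0 <= t <= 1 ->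
  pen (x + t *: (z - x)) <= pen x + t * (pen z - pen x).
Proof.
case: penP => ub att /andP[t0 t1].
have [i ->] := att (x + t *: (z - x)).
rewrite dotvDr dotvZr dotvBr.
have := ub i x; have := ub i z; nra.
Qed.

Lemma active_subdifferential beta i :
  dotv (u i) beta = pen beta -> subdifferential pen beta (u i).
Proof. by move=> act z; rewrite dotvBr act subrKC penP.1. Qed.

(** A vector active at beta is a subgradient there, hence at b; and since pen
    vanishes at the origin, a subgradient u_i at b satisfies
    pen b <= u_i'b, so that u_i is active at b. *)
Lemma pen_equiv_active b beta i : pen_equiv pen b beta ->
  dotv (u i) beta = pen beta -> dotv (u i) b = pen b.
Proof.
move=> eqv /active_subdifferential; rewrite -eqv => /(_ 0).
have [j ->] := penP.2 0; rewrite sub0r dotvNr dotv0r => pen_le.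
by apply/le_anti; rewrite penP.1/=; lra.
Qed.

Lemma lin_pattern_class_active beta v : lin (pattern_class pen beta) v ->
  exists c, forall i, dotv (u i) beta = pen beta -> dotv (u i) v = c.
Proof.
move: v; apply: lin_ind => [|a b v bC [c vc]]; first by exists 0 => i _; rewrite dotv0r.
exists (a * pen b + c) => i act.
by rewrite dotvDr dotvZr (pen_equiv_active _ _ _ bC act) vc.
Qed.

(** The forms active at beta all grow with slope c along v; those that are
    inactive need some room to catch up with them. *)
Lemma max_of_forms_affine beta v c :
  (forall i, dotv (u i) beta = pen beta -> dotv (u i) v = c) ->
  exists2 e : R, 0 < e &
    forall t, `|t| <= e -> pen (beta + t *: v) = pen beta + t * c.
Proof.
move=> slope; case: penP => ub att.
(* Form i is below the maximum by g at t = 0 and gains at most |t| a on it,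
   hence stays below as long as |t| <= g / (1 + a); 1 avoids dividing by 0. *)
pose room i := (pen beta - dotv (u i) beta) / (1 + `|dotv (u i) v - c|).
have den0 i : 0 < 1 + `|dotv (u i) v - c| by rewrite ltr_wpDr.
exists (\big[Num.min/1]_(i | dotv (u i) beta != pen beta) room i).
  apply/bigmin_gtP; split=> // i inact.
  by rewrite divr_gt0// subr_gt0 lt_neqAle inact ub.
move=> t /bigmin_geP[_ t_le]; apply/le_anti/andP; split; last first.
  have [i act] := att beta.
  by have := ub i (beta + t *: v); rewrite dotvDr dotvZr slope -?act.
have [i ->] := att (beta + t *: v); rewrite dotvDr dotvZr.
have [act|inact] := eqVneq (dotv (u i) beta) (pen beta).
  by rewrite act slope.
have := t_le i inact; rewrite ler_pdivlMr// mulrDr mulr1 -normrM => t_le_i.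
have := ler_norm (t * (dotv (u i) v - c)); have := normr_ge0 t.
lra.
Qed.

Lemma pattern_class_shift beta v : lin (pattern_class pen beta) v ->
  exists2 e : R, 0 < e & forall t, `|t| <= e -> pen_equiv pen (beta + t *: v) beta.
Proof.
move=> /lin_pattern_class_active[c /(max_of_forms_affine _ _ c)[e e0 aff]].
(* Half the radius, so that beta + 2 t v is still in the affine range. *)
exists (e / 2) => [|t te]; first by rewrite divr_gt0.
have affN : pen (beta - t *: v) = pen beta - t * c.
  by rewrite -scaleNr aff ?mulNr// normrN; lra.
have aff1 : pen (beta + t *: v) = pen beta + t * c by rewrite aff//; lra.
have aff2 : pen (beta + t *: v + t *: v) = pen beta + t * c + t * c.
  by rewrite -addrA -scalerDl aff ?mulrDl ?addrA// (le_trans (ler_normD _ _))//; lra.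
apply/seteqP; split; last exact: (subdifferential_shift _ _ _ _ aff1 affN).
rewrite -[X in _ `<=` subdifferential _ X](addrK (t *: v)).
by apply: (subdifferential_shift _ _ _ (- (t * c)));
  rewrite ?addrK ?opprK ?aff2 aff1 ?addrK.
Qed.

End MaxOfForms.

Lemma polyhedral_gauge_max {R : realType} {p : nat} (pen : 'cV[R]_p -> R) :
  polyhedral_gauge pen ->
  exists k (u : 'I_k -> 'cV[R]_p), max_of_forms u pen.
Proof.
move=> [k [u [_ penE]]]; exists k.+1, u; split=> [i b|b]; rewrite penE.
  exact: (le_bigmax _ (fun j => dotv (u j) b)).
elim/big_ind: _ => [|_ _ [i ->] [j ->]|i _]; [by exists ord0| |by exists i].
by rewrite maxEle; case: ifP => _; [exists j|exists i].
Qed.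

(** * Noiseless recovery *)

Theorem proposition4p7 (R : realType) (n p : nat) (X : 'M[R]_(n, p))
    (pen : 'cV[R]_p -> R) (beta : 'cV[R]_p) :
  polyhedral_gauge pen ->
  noiseless_recovery X pen beta <->
  ((fun v : 'cV[R]_p => X^T *m X *m v) @` lin (pattern_class pen beta))
    `&` subdifferential pen beta !=set0.
Proof.
move=> /polyhedral_gauge_max[k [u penP]].
have optP lambda y b s :=
  penalized_lsP X pen lambda y b s (max_of_forms_chord u pen penP).
split=> [[lambda l0 [b bmin beqv]] | [_ [[v vlin <-] sub]]].
  exists (X^T *m X *m (lambda^-1 *: (beta - b))); split.
    by exists (lambda^-1 *: (beta - b)) => //; apply: lin_scaleB.
  rewrite -beqv; apply: (optP lambda (X *m beta) _ _ l0 _).1 bmin.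
  by rewrite -scalemxAr scalerA divff ?gt_eqF// scale1r -mulmxBr mulmxA.
have [e e0 /(_ (- e))] := pattern_class_shift u pen penP _ _ vlin.
rewrite normrN gtr0_norm// lexx scaleNr => /(_ isT) beqv.
exists e => //; exists (beta - e *: v) => //.
apply: (optP e (X *m beta) _ (X^T *m X *m v) e0 _).2; last by rewrite beqv.
by rewrite -mulmxBr subKr mulmxA -scalemxAr.
Qed.
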